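(* Let $-1\le B<A\le 1$ with $B\ne 0$, let $f\in\mathcal{S}^*(A,B)$ with logarithmic coefficients $\gamma_n$, and let $t\le 2$ be a real number. Then $$\sum_{n=1}^{\infty} (n+1)^t|\gamma_n|^2 \le \left(\frac{A-B}{2B}\right)^2\sum_{n=1}^{\infty}\frac{(n+1)^t}{n^2}|B|^{2n},$$ where the right-hand side is read as $+\infty$ if the series diverges.
   Context: $\mathbb{D}=\{z\in\mathbb{C}:|z|<1\}$. $\mathcal{A}$ is the class of analytic functions $f$ on $\mathbb{D}$ with $f(0)=f'(0)-1=0$. For analytic $F,G$ in $\mathbb{D}$, $F\prec G$ ($F$ is subordinate to $G$) means there is an analytic $\phi$ on $\mathbb{D}$ with $\phi(0)=0$, $|\phi(z)|<1$ on $\mathbb{D}$ and $F=G\circ\phi$. For $-1\le B<A\le 1$, $$\mathcal{S}^*(A,B)=\left\{f\in\mathcal{A}:\ \frac{zf'(z)}{f(z)}\prec\frac{1+Az}{1+Bz},\ z\in\mathbb{D}\right\}$$ (in particular $zf'/f$ is analytic in $\mathbb{D}$, so $f(z)/z$ is nonvanishing). The logarithmic coefficients $\gamma_n=\gamma_n(f)$ are defined by $\log\frac{f(z)}{z}=2\sum_{n=1}^\infty\gamma_n z^n$ for $z\in\mathbb{D}$, with the branch of the logarithm vanishing at $z=0$. *)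

(* Defs.v *)
From Stdlib Require Import Reals.
From Coquelicot Require Import Coquelicot.

Local Open Scope C_scope.

Definition disk (z : C) : Prop := (Cmod z < 1)%R.

Definition analytic_at (f : C -> C) (z0 : C) : Prop :=
  exists (a : nat -> C) (r : R), (0 < r)%R /\
    forall z : C, (Cmod (z - z0) < r)%R ->
      @is_pseries C_AbsRing C_NormedModule a (z - z0) (f z).

(* Functions on the disk are total functions C -> C; their values outside the
   disk play no role. *)
Definition analytic_on_disk (f : C -> C) : Prop :=
  forall z : C, disk z -> analytic_at f z.

Definition subordinate (F G : C -> C) : Prop :=
  analytic_on_disk F /\ analytic_on_disk G /\
  exists phi : C -> C,
    analytic_on_disk phi /\
    phi 0 = 0 /\
    (forall z : C, disk z -> (Cmod (phi z) < 1)%R) /\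
    (forall z : C, disk z -> F z = G (phi z)).

Definition normalized_class (f : C -> C) : Prop :=
  analytic_on_disk f /\ f 0 = 0 /\ C_derive f 0 - 1 = 0.

(* The quotient z f'(z) / f(z) is 0/0 at the origin, where its analytic
   extension takes the value 1 because f(0) = 0 and f'(0) = 1. *)
Definition starlike_quotient (f : C -> C) (z : C) : C :=
  if Ceq_dec z 0 then 1 else z * C_derive f z / f z.

(* Division is total in Coquelicot, so the nonvanishing of f(z) / z, which is
   implicit in the analyticity of z f'(z) / f(z), is stated explicitly. *)
Definition starlike_class (A B : R) (f : C -> C) : Prop :=
  normalized_class f /\
  (forall z : C, disk z -> z <> 0 -> f z <> 0) /\
  subordinate (starlike_quotient f)
    (fun z => (1 + RtoC A * z) / (1 + RtoC B * z)).

Definition Cexp (z : C) : C := RtoC (exp (Re z)) * (cos (Im z), sin (Im z)).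

(* L is the branch of log (f(z) / z) on the disk that vanishes at 0; at z = 0
   the equation exp L = f(z) / z holds by continuity. *)
Definition log_branch (f L : C -> C) : Prop :=
  analytic_on_disk L /\ L 0 = 0 /\
  (forall z : C, disk z -> z <> 0 -> Cexp (L z) = f z / z).

(* Only gamma 1, gamma 2, ... are constrained; gamma 0 is irrelevant. *)
Definition log_coefficients (f : C -> C) (gamma : nat -> C) : Prop :=
  exists L : C -> C,
    log_branch f L /\
    forall z : C, disk z ->
      exists s : C,
        @is_series C_AbsRing C_NormedModule
          (fun n => gamma (S n) * z ^ (S n)) s /\
        L z = 2 * s.

(* For nonnegative terms the partial sums increase, so this is the value in
   [0, +oo] of the series sum_{n >= 1} a n. *)
Definition series_from_1 (a : nat -> R) : Rbar :=
  Lim_seq (fun N => sum_n_m a 1 N).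

(* Main.v *)
Require Import Defs.
From Stdlib Require Import Reals Lra Lia.
From Coquelicot Require Import Coquelicot.
Local Open Scope R_scope.

(** Let [L] be the branch of log (f(z)/z) and [P(z) = z L'(z)], whose Taylor
    coefficients are [d n = 2 n gamma n]. Since [z f'/f = 1 + P], the
    subordination says [P = phi (A - B - B P)] for some analytic [phi] with
    [phi 0 = 0] and [|phi| < 1] ([subordination_equation]).

    A function satisfying such an equation has its coefficients controlled by
    Clunie's method ([Clunie_inequality]):
    the sum of [|d k|^2] over [k <= N + 1] is at most [(A - B)^2] plus [B^2]
    times the sum over [k <= N]. By induction the partial sums of [|d k|^2] are
    at most those of the geometric sequence [(A - B)^2 B^(2 (k - 1))]
    ([sum_le_geometric]), which belongs to the extremal [phi(z) = z].

    Finally [(n + 1)^t |gamma n|^2] is [|d n|^2] times the weight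
    [(n + 1)^t / (4 n^2)], which is nonincreasing because [t <= 2]
    ([weight_decreasing]); summation by parts ([weighted_sum_le]) transfers the
    inequality between unweighted partial sums to the weighted ones, and the
    partial sums of both series of the theorem are then compared one by one.

    The analytic input is the mean value property of holomorphic functions on
    circles ([circle_mean_value]), obtained by differentiating the circle
    integral in the radius; Parseval's identity for polynomials and the
    vanishing of the cross terms in Clunie's argument both follow from it. *)

(** * Complex derivatives *)

Notation is_Cpseries a z l :=
  (@is_pseries C_AbsRing C_NormedModule a z l).
Notation is_Cseries u l := (@is_series C_AbsRing C_NormedModule u l).

(** The target is the ring as a module over itself, for which the general
    theory has the product rule; its norm is again [Cmod], so this is the usual
    complex derivative. *)
Notation C_abs_module := (AbsRing_NormedModule C_AbsRing).
Notation is_Cderive f z l :=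
  (@is_derive C_AbsRing C_abs_module f z l).
Notation C_abs_space := (AbsRing_UniformSpace C_AbsRing).
Notation R2_space := (prod_UniformSpace R_UniformSpace R_UniformSpace).
Notation Ccontinuous f z :=
  (@continuous C_abs_space C_abs_space f z).

(* The generic operations of the algebraic hierarchy are convertible to the
   concrete ones, but [ring] and [rewrite] only see the latter. *)
Ltac Cops := repeat match goal with
  | |- context [@plus ?G ?x ?y] => change (@plus G x y) with (Cplus x y)
  | |- context [@opp ?G ?x] => change (@opp G x) with (Copp x)
  | |- context [@mult ?G ?x ?y] => change (@mult G x y) with (Cmult x y)
  | |- context [@scal ?K ?V ?x ?y] => change (@scal K V x y) with (Cmult x y)
  | |- context [@zero ?G] => change (@zero G) with (RtoC 0)
  | |- context [@one ?G] => change (@one G) with (RtoC 1)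
  end.

Ltac Rops := repeat match goal with
  | |- context [@plus ?G ?x ?y] => change (@plus G x y) with (Rplus x y)
  | |- context [@mult ?G ?x ?y] => change (@mult G x y) with (Rmult x y)
  | |- context [@scal ?K ?V ?x ?y] => change (@scal K V x y) with (Rmult x y)
  end; try match goal with |- ?a = ?b => change (@eq R a b) end.

Lemma is_derive_iff (K : AbsRing) (f : K -> K) (x l : K) :
  @is_derive K (AbsRing_NormedModule K) f x l <->
  forall eps : posreal, exists delta : posreal, forall y : K,
    abs (minus y x) < delta ->
    abs (minus (minus (f y) (f x)) (mult (minus y x) l)) <= eps * abs (minus y x).
Proof.
  split.
  - intros [_ H] eps.
    destruct (H x (fun P H => H) eps) as [delta Hd].
    exists delta; intros y Hy; exact (Hd y Hy).
  - intros H; split.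
    + apply is_linear_scal_l.
    + intros x' Hx eps.
      apply (@is_filter_lim_locally_unique K (AbsRing_NormedModule K)) in Hx.
      rewrite <- Hx.
      destruct (H eps) as [delta Hd].
      exists delta; intros y Hy; exact (Hd y Hy).
Qed.

Lemma is_Cderive_iff (f : C -> C) (z l : C) :
  is_Cderive f z l <->
  forall eps : posreal, exists delta : posreal, forall w : C,
    Cmod (w - z) < delta ->
    Cmod (f w - f z - (w - z) * l) <= eps * Cmod (w - z).
Proof. exact (is_derive_iff C_AbsRing f z l). Qed.

Lemma is_Rderive_iff (f : R -> R) (x l : R) :
  is_derive f x l <->
  forall eps : posreal, exists delta : posreal, forall y : R,
    Rabs (y - x) < delta ->
    Rabs (f y - f x - (y - x) * l) <= eps * Rabs (y - x).
Proof. exact (is_derive_iff R_AbsRing f x l). Qed.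

Lemma is_Cderive_C_derive (f : C -> C) (z l : C) :
  is_Cderive f z l -> C_derive f z = l.
Proof.
  intros [[H1 H2 H3] H]; apply is_C_derive_unique.
  split; [split|]; auto.
Qed.

Lemma is_Cpseries_iff (a : nat -> C) (z l : C) :
  is_Cpseries a z l <->
  is_Cseries (fun n => (z ^ n * a n)%C) l.
Proof.
  exact (iff_refl _).
Qed.

(** * Differentiating complex power series *)

Lemma Cseries_bound (u : nat -> C) (l : C) (M : R) :
  is_Cseries u l ->
  (forall N, sum_n (fun n => Cmod (u n)) N <= M) -> Cmod l <= M.
Proof.
  intros Hl HM.
  apply (is_lim_seq_le (fun N => @norm C_AbsRing C_NormedModule (sum_n u N))
    (fun _ => M) (Cmod l) M).
  - intros N. eapply Rle_trans; [|apply (HM N)].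
    apply (@norm_sum_n_m C_AbsRing C_NormedModule u 0 N).
  - apply (filterlim_comp _ _ _ _ _ _ _ _ Hl).
    apply (@filterlim_norm C_AbsRing C_NormedModule).
  - apply is_lim_seq_const.
Qed.

(** Second-order Taylor estimate for a power. The remainders obey
    T_(m+1) = x T_m + m w^(m-1) (x - w)^2, whence the induction. *)
Lemma Cpow_taylor_bound (w x : C) (s : R) (n : nat) :
  Cmod w <= s -> Cmod x <= s ->
  Cmod (x ^ S (S n) - w ^ S (S n) - (x - w) * (RtoC (INR (S (S n))) * w ^ S n))
  <= INR (S n) * INR (S (S n)) * s ^ n * Cmod (x - w) ^ 2.
Proof.
  intros Hw Hx.
  assert (H0 := Cmod_ge_0 (x - w)).
  assert (Hs : 0 <= s) by (apply Rle_trans with (2 := Hw), Cmod_ge_0).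
  induction n as [|n IH].
  - replace (x ^ 2 - w ^ 2 - _)%C with ((x - w) ^ 2)%C.
    + rewrite Cmod_pow. simpl. nra.
    + change (INR 2) with (1 + 1). rewrite RtoC_plus. ring.
  - set (m := S n) in *.
    replace (x ^ S (S m) - w ^ S (S m) - _)%C with
      (x * (x ^ S m - w ^ S m - (x - w) * (RtoC (INR (S m)) * w ^ m))
       + RtoC (INR (S m)) * w ^ m * (x - w) ^ 2)%C.
    + eapply Rle_trans; [apply Cmod_triangle|].
      rewrite !Cmod_mult, !Cmod_pow, Cmod_R, Rabs_pos_eq by apply pos_INR.
      assert (Hp : Cmod w ^ m <= s ^ m).
      { apply pow_incr; split; [apply Cmod_ge_0|exact Hw]. }
      assert (Hsm := pow_le s m Hs).
      assert (Hm := pos_INR m). assert (HSm := pos_INR (S m)).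
      set (q := Cmod (x - w)) in *.
      assert (Hq : 0 <= q ^ 2) by nra.
      apply Rle_trans with
        (s * (INR m * INR (S m) * s ^ n * q ^ 2) + INR (S m) * s ^ m * q ^ 2).
      * apply Rplus_le_compat.
        -- apply Rmult_le_compat; auto using Cmod_ge_0.
        -- apply Rmult_le_compat_r; auto. apply Rmult_le_compat_l; auto.
      * replace (s * (INR m * INR (S m) * s ^ n * q ^ 2)) with
          (INR m * INR (S m) * s ^ m * q ^ 2) by (unfold m; simpl pow; ring).
        rewrite (S_INR (S m)), (S_INR m).
        assert (0 <= s ^ m * q ^ 2) by (apply Rmult_le_pos; auto).
        nra.
    + rewrite (S_INR (S m)), RtoC_plus.
      rewrite !(Cpow_S _ (S m)), !(Cpow_S _ m). ring.
Qed.

(** The terms of a convergent power series are bounded, so the real series of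
    the moduli has radius of convergence at least [rho], and so have its first
    two formal derivatives. *)
Lemma Cpseries_derive2_bound (a : nat -> C) (rho s : R) :
  (forall w, Cmod w < rho -> exists l, is_Cpseries a w l) ->
  0 <= s < rho ->
  ex_series (fun n => INR (S n) * Cmod (a (S n)) * s ^ n) /\
  ex_series (fun n => INR (S n) * INR (S (S n)) * s ^ n * Cmod (a (S (S n)))).
Proof.
  intros Ha Hs.
  set (b := fun n => Cmod (a n)).
  assert (Hrad : Rbar_lt (Rabs s) (CV_radius b)).
  { rewrite Rabs_pos_eq by lra.
    set (s' := (s + rho) / 2).
    apply Rbar_lt_le_trans with (Finite s'); [simpl; unfold s'; lra|].
    destruct (CV_radius_bounded b) as [Hub _]. apply Hub.
    destruct (Ha (RtoC s')) as [l Hl].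
    { rewrite Cmod_R, Rabs_pos_eq; unfold s'; lra. }
    apply is_Cpseries_iff in Hl.
    destruct (filterlim_bounded (sum_n (fun n => (RtoC s' ^ n * a n)%C))) as [M HM].
    { exists l; exact Hl. }
    exists (2 * M). intros n.
    assert (Hn : Cmod (RtoC s' ^ n * a n) <= 2 * M).
    { destruct n as [|n].
      - specialize (HM 0%nat). rewrite sum_O in HM.
        change (Cmod (RtoC s' ^ 0 * a 0%nat) <= M) in HM.
        assert (H := Cmod_ge_0 (RtoC s' ^ 0 * a 0%nat)). lra.
      - assert (H1 := HM n). assert (H2 := HM (S n)).
        rewrite sum_Sn in H2.
        set (S0 := sum_n (fun n => (RtoC s' ^ n * a n)%C) n) in *.
        change (Cmod S0 <= M) in H1.
        change (Cmod (S0 + RtoC s' ^ S n * a (S n)) <= M) in H2.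
        replace (RtoC s' ^ S n * a (S n))%C with
          ((S0 + RtoC s' ^ S n * a (S n)) + - S0)%C by ring.
        eapply Rle_trans; [apply Cmod_triangle|].
        rewrite Cmod_opp. lra. }
    rewrite Cmod_mult, Cmod_pow, Cmod_R, Rabs_pos_eq in Hn by (unfold s'; lra).
    unfold b. rewrite Rabs_mult, Rabs_pos_eq by apply Cmod_ge_0.
    rewrite <- RPow_abs, (Rabs_pos_eq s') by (unfold s'; lra). lra. }
  split.
  - assert (H := CV_radius_inside (PS_derive b) s).
    rewrite CV_radius_derive in H. specialize (H Hrad).
    destruct H as [l H]. exists l. revert H. apply is_series_ext.
    intros n. rewrite pow_n_pow. unfold PS_derive, b, scal; simpl.
    unfold mult; simpl. ring.
  - assert (H := CV_radius_inside (PS_derive (PS_derive b)) s).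
    rewrite !CV_radius_derive in H. specialize (H Hrad).
    destruct H as [l H]. exists l. revert H. apply is_series_ext.
    intros n. rewrite pow_n_pow. unfold PS_derive, b, scal.
    change (@mult R_AbsRing) with Rmult. simpl. unfold mult; simpl. ring.
Qed.

Definition pseries_derive (a : nat -> C) (n : nat) : C :=
  (RtoC (INR (S n)) * a (S n))%C.

Lemma ex_Cpseries_derive (a : nat -> C) (rho : R) (w : C) :
  (forall w, Cmod w < rho -> exists l, is_Cpseries a w l) ->
  Cmod w < rho -> exists l, is_Cpseries (pseries_derive a) w l.
Proof.
  intros Ha Hw.
  destruct (Cpseries_derive2_bound a rho (Cmod w) Ha) as [H _].
  { split; [apply Cmod_ge_0|exact Hw]. }
  destruct (@ex_series_le C_AbsRing C_CompleteNormedModule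
    (fun n => (w ^ n * pseries_derive a n)%C) _ (fun n => Req_le _ _ eq_refl)) as [l Hl].
  - eapply ex_series_ext; [|apply H].
    intros n.
    change (INR (S n) * Cmod (a (S n)) * Cmod w ^ n = Cmod (w ^ n * pseries_derive a n)).
    unfold pseries_derive.
    rewrite !Cmod_mult, Cmod_pow, Cmod_R, Rabs_pos_eq by apply pos_INR. ring.
  - exists l. apply is_Cpseries_iff. exact Hl.
Qed.

(** Summing the Taylor estimate of the monomials bounds the remainder of [f] at
    [w] by a constant times the square of the increment; the constant is the
    second formal derivative of the series of moduli, at a radius strictly
    between [Cmod w] and [rho]. *)
Lemma is_Cderive_pseries (a : nat -> C) (f : C -> C) (rho : R) (w l : C) :
  (forall w, Cmod w < rho -> is_Cpseries a w (f w)) ->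
  Cmod w < rho -> is_Cpseries (pseries_derive a) w l -> is_Cderive f w l.
Proof.
  intros Hf Hw Hl.
  set (s := (Cmod w + rho) / 2).
  assert (Hs : Cmod w < s < rho) by (unfold s; lra).
  assert (Hw0 := Cmod_ge_0 w).
  destruct (Cpseries_derive2_bound a rho s) as [_ [M HM]].
  { intros x Hx; exists (f x); auto. }
  { lra. }
  assert (HMN : forall N, sum_n (fun n =>
    INR (S n) * INR (S (S n)) * s ^ n * Cmod (a (S (S n)))) N <= M).
  { intros N. apply (is_lim_seq_incr_compare _ M HM).
    intros n. rewrite sum_Sn. change (@plus R_NormedModule) with Rplus.
    match goal with |- ?x <= ?x + ?y => assert (0 <= y) end; [|lra].
    apply Rmult_le_pos; [|apply Cmod_ge_0].
    apply Rmult_le_pos; [|apply pow_le; lra].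
    apply Rmult_le_pos; apply pos_INR. }
  assert (HM0 : 0 <= M).
  { eapply Rle_trans; [|apply (HMN 0%nat)]. rewrite sum_O. simpl.
    assert (H := Cmod_ge_0 (a 2%nat)). lra. }
  apply is_Cderive_iff. intros eps.
  assert (Hd : 0 < Rmin (s - Cmod w) (eps / (M + 1))).
  { apply Rmin_pos; [lra|]. apply Rdiv_lt_0_compat; [apply cond_pos|lra]. }
  exists (mkposreal _ Hd). simpl. intros x Hx.
  assert (Hxs : Cmod x <= s).
  { replace x with ((x - w) + w)%C by ring.
    eapply Rle_trans; [apply Cmod_triangle|].
    assert (H := Rmin_l (s - Cmod w) (eps / (M + 1))). lra. }
  assert (Hxe : Cmod (x - w) * M <= eps).
  { assert (H := Rmin_r (s - Cmod w) (eps / (M + 1))).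
    assert (H' : Cmod (x - w) * (M + 1) <= eps).
    { apply Rle_trans with (eps / (M + 1) * (M + 1)).
      - apply Rmult_le_compat_r; lra.
      - right; field; lra. }
    assert (H0 := Cmod_ge_0 (x - w)). lra. }
  set (u := fun n => (x ^ S (S n) * a (S (S n)) - w ^ S (S n) * a (S (S n))
      - (x - w) * (w ^ S n * pseries_derive a (S n)))%C).
  assert (Hu : is_Cseries u (f x - f w - (x - w) * l)%C).
  (* The derived series is written with its terms moved up by one, so that all
     three series run over the same powers; the terms 0 and 1 of [v] vanish. *)
  { pose (v := fun n => (x ^ n * a n - w ^ n * a n - (x - w) *
       match n with 0%nat => 0 | S m => w ^ m * pseries_derive a m end)%C).
    assert (Hv : is_Cseries v (f x - f w - (x - w) * l)%C).
    { unfold v, Cminus.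
      apply (@is_series_plus C_AbsRing C_NormedModule).
      - apply (@is_series_plus C_AbsRing C_NormedModule).
        + apply is_Cpseries_iff, Hf; lra.
        + apply (@is_series_opp C_AbsRing C_NormedModule).
          apply is_Cpseries_iff, Hf; lra.
      - apply (@is_series_opp C_AbsRing C_NormedModule).
        apply (@is_series_scal C_AbsRing C_NormedModule).
        apply is_series_decr_1.
        replace (plus l _) with l.
        + apply is_Cpseries_iff, Hl.
        + change (l = (l + - 0)%C). ring. }
    assert (Hv2 : @is_series C_AbsRing C_NormedModule
       (fun n => v (S (S n))) (f x - f w - (x - w) * l)%C).
    { apply (@is_series_incr_1 C_AbsRing C_NormedModule (fun n => v (S n))).
      replace (plus _ (v 1%nat)) with (f x - f w - (x - w) * l)%C.
      - apply is_series_incr_1.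
        replace (plus _ (v 0%nat)) with (f x - f w - (x - w) * l)%C; [exact Hv|].
        unfold v. Cops. simpl. ring.
      - unfold v, pseries_derive. Cops.
        change (INR 1) with 1. simpl. ring. }
    exact Hv2. }
  apply Rle_trans with (M * Cmod (x - w) ^ 2).
  - apply (Cseries_bound u _ _ Hu). intros N.
    apply Rle_trans with (Cmod (x - w) ^ 2 *
      sum_n (fun n => INR (S n) * INR (S (S n)) * s ^ n * Cmod (a (S (S n)))) N).
    + eapply Rle_trans; [|right; apply (@sum_n_mult_l R_Ring)].
      apply sum_n_m_le. intros n. unfold u, pseries_derive.
      replace (x ^ S (S n) * a (S (S n)) - _ - _)%C with
        ((x ^ S (S n) - w ^ S (S n) - (x - w) * (RtoC (INR (S (S n))) * w ^ S n))
         * a (S (S n)))%C by ring.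
      rewrite Cmod_mult.
      assert (H := Cpow_taylor_bound w x s n ltac:(lra) Hxs).
      apply Rmult_le_compat_r with (r := Cmod (a (S (S n)))) in H; [|apply Cmod_ge_0].
      eapply Rle_trans; [exact H|]. right. change (@mult R_Ring) with Rmult. ring.
    + rewrite Rmult_comm. apply Rmult_le_compat_r; [apply pow2_ge_0|apply HMN].
  - assert (H := Cmod_ge_0 (x - w)). nra.
Qed.

(** * Continuously differentiable functions on the disk *)

(** Differentiation under the integral sign needs a continuous derivative.
    Every holomorphic function has one, but here it is read off the local power
    series, and carrying it in the class makes the closure properties direct. *)
Definition C1_on_disk (H : C -> C) : Prop :=
  exists H' : C -> C, forall z, disk z -> is_Cderive H z (H' z) /\ Ccontinuous H' z.

Lemma is_Cderive_continuous (f : C -> C) (z l : C) :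
  is_Cderive f z l -> Ccontinuous f z.
Proof.
  intros H.
  apply (@ex_derive_continuous C_AbsRing C_abs_module).
  exists l; exact H.
Qed.

Lemma C1_on_disk_ext (F G : C -> C) :
  (forall z, F z = G z) -> C1_on_disk F -> C1_on_disk G.
Proof.
  intros E [F' HF]. exists F'. intros z Hz. destruct (HF z Hz) as [H1 H2].
  split; auto. now apply (@is_derive_ext C_AbsRing C_abs_module F).
Qed.

Lemma C1_on_disk_const (c : C) : C1_on_disk (fun _ => c).
Proof.
  exists (fun _ => RtoC 0). intros z _. split.
  - apply (@is_derive_const C_AbsRing C_abs_module).
  - apply (@continuous_const C_abs_space C_abs_space).
Qed.

Lemma C1_on_disk_id : C1_on_disk (fun z => z).
Proof.
  exists (fun _ => RtoC 1). intros z _. split.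
  - apply (@is_derive_id C_AbsRing).
  - apply (@continuous_const C_abs_space C_abs_space).
Qed.

Lemma C1_on_disk_plus (F G : C -> C) :
  C1_on_disk F -> C1_on_disk G -> C1_on_disk (fun z => F z + G z)%C.
Proof.
  intros [F' HF] [G' HG]. exists (fun z => F' z + G' z)%C.
  intros z Hz. destruct (HF z Hz), (HG z Hz). split.
  - now apply (@is_derive_plus C_AbsRing C_abs_module).
  - now apply (@continuous_plus C_abs_space C_AbsRing C_abs_module).
Qed.

Lemma C1_on_disk_mult (F G : C -> C) :
  C1_on_disk F -> C1_on_disk G -> C1_on_disk (fun z => F z * G z)%C.
Proof.
  intros [F' HF] [G' HG]. exists (fun z => F' z * G z + F z * G' z)%C.
  intros z Hz. destruct (HF z Hz), (HG z Hz). split.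
  - apply (@is_derive_mult C_AbsRing); auto. exact Cmult_comm.
  - apply (@continuous_plus C_abs_space C_AbsRing C_abs_module);
    apply (@continuous_mult C_abs_space C_AbsRing); auto;
    eapply is_Cderive_continuous; eauto.
Qed.

Lemma C1_on_disk_pow (n : nat) : C1_on_disk (fun z => z ^ n)%C.
Proof.
  induction n as [|n IH].
  - exact (C1_on_disk_const 1).
  - exact (C1_on_disk_mult _ _ C1_on_disk_id IH).
Qed.

Lemma C1_on_disk_sum (F : nat -> C -> C) (N : nat) :
  (forall n, C1_on_disk (F n)) ->
  C1_on_disk (fun z => @sum_n C_AbelianMonoid (fun n => F n z) N).
Proof.
  intros HF. induction N as [|N IH].
  - apply (C1_on_disk_ext (F 0%nat)); auto. intros z. now rewrite sum_O.
  - apply (C1_on_disk_ext (fun z => @sum_n C_AbelianMonoid (fun n => F n z) N + F (S N) z)%C).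
    + intros z. now rewrite sum_Sn.
    + now apply C1_on_disk_plus.
Qed.

(** The derived series has the same disk of convergence, so it can be
    differentiated again; this gives the continuity of the derivative. *)
Lemma pseries_C1_at (a : nat -> C) (f : C -> C) (rho : R) :
  (forall w, Cmod w < rho -> is_Cpseries a w (f w)) ->
  forall w, Cmod w < rho ->
  is_Cderive f w (C_derive f w) /\ Ccontinuous (C_derive f) w /\
  is_Cpseries (pseries_derive a) w (C_derive f w).
Proof.
  intros Hf.
  assert (Ha : forall w, Cmod w < rho -> exists l, is_Cpseries a w l)
    by (intros w Hw; exists (f w); auto).
  assert (H1 : forall w, Cmod w < rho ->
    is_Cderive f w (C_derive f w) /\ is_Cpseries (pseries_derive a) w (C_derive f w)).
  { intros w Hw. destruct (ex_Cpseries_derive a rho w Ha Hw) as [l Hl].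
    assert (H := is_Cderive_pseries a f rho w l Hf Hw Hl).
    rewrite (is_Cderive_C_derive _ _ _ H). auto. }
  intros w Hw. destruct (H1 w Hw) as [H2 H3]. split; [|split]; auto.
  destruct (ex_Cpseries_derive (pseries_derive a) rho w) as [l Hl]; auto.
  { intros x Hx. exists (C_derive f x). now apply H1. }
  apply is_Cderive_continuous with l.
  apply (is_Cderive_pseries (pseries_derive a) _ rho); auto.
  intros x Hx; now apply H1.
Qed.

Lemma analytic_is_Cderive (f : C -> C) (z : C) :
  analytic_at f z -> is_Cderive f z (C_derive f z) /\ Ccontinuous (C_derive f) z.
Proof.
  intros (a & r & Hr & Ha).
  pose (g := fun w => f (w + z)%C).
  assert (Hg : forall w, Cmod w < r -> is_Cpseries a w (g w)).
  { intros w Hw. unfold g. replace w with (w + z - z)%C at 1 by ring.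
    apply Ha. now replace (w + z - z)%C with w by ring. }
  assert (Hgf : forall w l, is_Cderive g w l -> is_Cderive f (w + z)%C l).
  { intros w l. rewrite !is_Cderive_iff. intros H eps.
    destruct (H eps) as [d Hd]. exists d. intros x Hx.
    specialize (Hd (x - z)%C). unfold g in Hd.
    replace (x - z - w)%C with (x - (w + z))%C in Hd by ring.
    replace (x - z + z)%C with x in Hd by ring. now apply Hd. }
  assert (Hder : forall w, Cmod w < r -> C_derive f (w + z)%C = C_derive g w).
  { intros w Hw. apply is_Cderive_C_derive, Hgf.
    now apply (pseries_C1_at a g r Hg). }
  assert (H0 : Cmod 0 < r) by (rewrite Cmod_0; exact Hr).
  destruct (pseries_C1_at a g r Hg 0 H0) as (H1 & H2 & _).
  assert (Hz : (0 + z)%C = z) by ring.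
  assert (E := Hder 0 H0). rewrite Hz in E. split.
  - rewrite E. rewrite <- Hz. now apply Hgf.
  - apply (continuous_ext_loc (T := C_abs_space) (U := C_abs_space)
      (C_derive f) (fun x => C_derive g (x - z)%C)).
    + exists (mkposreal r Hr). intros x Hx.
      change (Cmod (x - z) < r) in Hx.
      rewrite <- (Hder _ Hx). f_equal. ring.
    + apply (@continuous_comp C_abs_space C_abs_space C_abs_space
        (fun x => x - z)%C (C_derive g)).
      * apply is_Cderive_continuous with (1 + 0)%C.
        apply (@is_derive_plus C_AbsRing C_abs_module).
        -- apply (@is_derive_id C_AbsRing).
        -- apply (@is_derive_const C_AbsRing C_abs_module).
      * replace (z - z)%C with (RtoC 0) by ring. exact H2.
Qed.

Lemma analytic_on_disk_C1 (f : C -> C) : analytic_on_disk f -> C1_on_disk f.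
Proof. intros Hf. exists (C_derive f). intros z Hz. now apply analytic_is_Cderive, Hf. Qed.

Lemma pseries_C1_on_disk (a : nat -> C) (f : C -> C) :
  (forall z, disk z -> is_Cpseries a z (f z)) -> C1_on_disk f.
Proof.
  intros Hf. exists (C_derive f). intros z Hz.
  destruct (pseries_C1_at a f 1 Hf z Hz) as (H1 & H2 & _). auto.
Qed.

(** * The mean value property on circles *)

Lemma Cmod_le_Re_Im (z : C) : Cmod z <= Rabs (Re z) + Rabs (Im z).
Proof.
  destruct z as [x y]. unfold Cmod, Re, Im; simpl fst; simpl snd.
  assert (Hx := Rabs_pos x). assert (Hy := Rabs_pos y).
  rewrite <- (sqrt_pow2 (Rabs x + Rabs y)) by lra.
  apply sqrt_le_1_alt. rewrite <- (pow2_abs x), <- (pow2_abs y). nra.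
Qed.

Lemma Rabs_Im_le_Cmod (z : C) : Rabs (Im z) <= Cmod z.
Proof.
  eapply Rle_trans; [|apply Rmax_Cmod]. apply Rmax_r.
Qed.

(** Real and imaginary parts are differentiated separately because the theory
    of integrals with a parameter is about real functions of real variables. *)
Lemma is_derive_along_path (H : C -> C) (g : R -> C) (s : R) (l d : C) :
  is_Cderive H (g s) l ->
  is_derive (fun u => Re (g u)) s (Re d) ->
  is_derive (fun u => Im (g u)) s (Im d) ->
  is_derive (fun u => Re (H (g u))) s (Re (l * d)) /\
  is_derive (fun u => Im (H (g u))) s (Im (l * d)).
Proof.
  rewrite is_Cderive_iff, !is_Rderive_iff. intros HH Hre Him.
  assert (key : forall eps : posreal, exists delta : posreal, forall y : R,
    Rabs (y - s) < delta ->
    Cmod (H (g y) - H (g s) - RtoC (y - s) * (l * d)) <= eps * Rabs (y - s)).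
  { intros eps.
    assert (Hl := Cmod_ge_0 l). assert (Hd := Cmod_ge_0 d).
    assert (He := cond_pos eps).
    (* The error is the remainder of [H] over a step of length at most
       (|d| + 2) |y - s|, plus |l| times the remainder of [g], which is at most
       2 e2 |y - s|; [e1] and [e2] give half of [eps] to each, and e2 <= 1
       bounds the step. *)
    assert (He1 : 0 < eps / (2 * (Cmod d + 2))) by (apply Rdiv_lt_0_compat; lra).
    assert (He2 : 0 < Rmin 1 (eps / (4 * (Cmod l + 1)))).
    { apply Rmin_pos; [lra|apply Rdiv_lt_0_compat; lra]. }
    set (e1 := eps / (2 * (Cmod d + 2))) in *.
    set (e2 := Rmin 1 (eps / (4 * (Cmod l + 1)))) in *.
    destruct (HH (mkposreal _ He1)) as [d1 Hd1].
    destruct (Hre (mkposreal _ He2)) as [d2 Hd2].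
    destruct (Him (mkposreal _ He2)) as [d3 Hd3].
    simpl in Hd1, Hd2, Hd3.
    assert (Hd4 : 0 < d1 / (Cmod d + 3)).
    { apply Rdiv_lt_0_compat; [apply cond_pos|lra]. }
    assert (Hmin : 0 < Rmin (d1 / (Cmod d + 3)) (Rmin d2 d3)).
    { repeat apply Rmin_pos; auto; apply cond_pos. }
    exists (mkposreal _ Hmin). simpl. intros y Hy.
    assert (Hy1 := Rlt_le_trans _ _ _ Hy (Rmin_l _ _)).
    assert (Hy23 := Rlt_le_trans _ _ _ Hy (Rmin_r _ _)).
    specialize (Hd2 y (Rlt_le_trans _ _ _ Hy23 (Rmin_l _ _))).
    specialize (Hd3 y (Rlt_le_trans _ _ _ Hy23 (Rmin_r _ _))).
    assert (Hq := Rabs_pos (y - s)). set (q := Rabs (y - s)) in *.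
    assert (Hg : Cmod (g y - g s - RtoC (y - s) * d) <= 2 * e2 * q).
    { eapply Rle_trans; [apply Cmod_le_Re_Im|].
      replace (Re (g y - g s - RtoC (y - s) * d))
        with (Re (g y) - Re (g s) - (y - s) * Re d)
        by (unfold Re; simpl; ring).
      replace (Im (g y - g s - RtoC (y - s) * d))
        with (Im (g y) - Im (g s) - (y - s) * Im d)
        by (unfold Im; simpl; ring).
      lra. }
    assert (He21 : e2 <= 1) by apply Rmin_l.
    assert (He2l : e2 * (4 * (Cmod l + 1)) <= eps).
    { apply Rle_trans with (eps / (4 * (Cmod l + 1)) * (4 * (Cmod l + 1))).
      - apply Rmult_le_compat_r; [lra|apply Rmin_r].
      - right; field; lra. }
    assert (Hg2 : Cmod (g y - g s) <= (Cmod d + 2) * q).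
    { replace (g y - g s)%C with ((g y - g s - RtoC (y - s) * d) + RtoC (y - s) * d)%C by ring.
      eapply Rle_trans; [apply Cmod_triangle|].
      rewrite Cmod_mult, Cmod_R. fold q. nra. }
    assert (Hg3 : Cmod (g y - g s) < d1).
    { apply Rle_lt_trans with ((Cmod d + 3) * q); [nra|].
      apply Rlt_le_trans with ((Cmod d + 3) * (d1 / (Cmod d + 3))).
      - apply Rmult_lt_compat_l; lra.
      - right; field; lra. }
    specialize (Hd1 _ Hg3).
    replace (H (g y) - H (g s) - RtoC (y - s) * (l * d))%C with
      ((H (g y) - H (g s) - (g y - g s) * l) + l * (g y - g s - RtoC (y - s) * d))%C by ring.
    eapply Rle_trans; [apply Cmod_triangle|]. rewrite Cmod_mult.
    apply Rle_trans with (e1 * ((Cmod d + 2) * q) + Cmod l * (2 * e2 * q)).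
    - apply Rplus_le_compat.
      + eapply Rle_trans; [exact Hd1|]. apply Rmult_le_compat_l; lra.
      + apply Rmult_le_compat_l; lra.
    - replace (e1 * ((Cmod d + 2) * q)) with (eps / 2 * q) by (unfold e1; field; lra).
      assert (Cmod l * (2 * e2) <= eps / 2) by nra. nra. }
  split; intros eps; destruct (key eps) as [delta Hdelta]; exists delta;
    intros y Hy; eapply Rle_trans; [|apply (Hdelta y Hy)| |apply (Hdelta y Hy)].
  - replace (Re (H (g y)) - Re (H (g s)) - (y - s) * Re (l * d)) with
      (Re (H (g y) - H (g s) - RtoC (y - s) * (l * d))) by (unfold Re; simpl; ring).
    apply re_le_Cmod.
  - replace (Im (H (g y)) - Im (H (g s)) - (y - s) * Im (l * d)) with
      (Im (H (g y) - H (g s) - RtoC (y - s) * (l * d))) by (unfold Im; simpl; ring).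
    apply Rabs_Im_le_Cmod.
Qed.

Definition circle (r theta : R) : C := (r * cos theta, r * sin theta).

Lemma Cmod_circle (r theta : R) : Cmod (circle r theta) = Rabs r.
Proof.
  unfold Cmod, circle; simpl fst; simpl snd. rewrite <- sqrt_Rsqr_abs. f_equal.
  assert (H := sin2_cos2 theta). unfold Rsqr in *. nra.
Qed.

Lemma continuous_to_pair (T U V : UniformSpace) (f : T -> U) (g : T -> V) (x : T) :
  continuous f x -> continuous g x ->
  @continuous T (prod_UniformSpace U V) (fun u => (f u, g u)) x.
Proof.
  intros Hf Hg P [eps HP].
  assert (H1 := Hf _ (locally_ball (f x) eps)).
  assert (H2 := Hg _ (locally_ball (g x) eps)).
  unfold filtermap in *. generalize (filter_and _ _ H1 H2).
  apply filter_imp. intros u [A B]. apply HP. split; assumption.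
Qed.

Lemma continuous_to_C (T : UniformSpace) (g : T -> C) (x : T) :
  continuous (fun u => Re (g u)) x -> continuous (fun u => Im (g u)) x ->
  @continuous T C_abs_space g x.
Proof.
  intros Hre Him P HP. apply locally_C in HP.
  apply (continuous_ext (fun u => (Re (g u), Im (g u))) g).
  { intros u. symmetry. apply surjective_pairing. }
  - now apply continuous_to_pair.
  - exact HP.
Qed.

Lemma continuous_Re (z : C) :
  @continuous C_abs_space R_UniformSpace Re z.
Proof.
  intros P [eps HP]. exists eps. intros w Hw. apply HP.
  change (Cmod (w - z) < eps) in Hw.
  change (Rabs (Re w - Re z) < eps).
  eapply Rle_lt_trans; [|exact Hw]. apply (re_le_Cmod (w - z)).
Qed.

Lemma continuous_circle (x : R * R) :
  @continuous R2_space C_abs_space (fun p => circle (fst p) (snd p)) x.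
Proof.
  apply continuous_to_C; unfold circle, Re, Im; simpl.
  - apply (@continuous_mult R2_space R_AbsRing).
    + apply continuous_fst.
    + apply (continuous_comp snd cos); [apply continuous_snd|].
      apply continuity_pt_filterlim, continuity_cos.
  - apply (@continuous_mult R2_space R_AbsRing).
    + apply continuous_fst.
    + apply (continuous_comp snd sin); [apply continuous_snd|].
      apply continuity_pt_filterlim, continuity_sin.
Qed.

Lemma disk_circle (r theta : R) : Rabs r < 1 -> disk (circle r theta).
Proof. intros H. unfold disk. now rewrite Cmod_circle. Qed.

Lemma is_derive_radial (H : C -> C) (l : C) (r theta : R) :
  is_Cderive H (circle r theta) l ->
  is_derive (fun u => Re (H (circle u theta))) r (Re (l * circle 1 theta)).
Proof.
  intros HH.
  apply (is_derive_along_path H (fun u => circle u theta) r l (circle 1 theta) HH);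
    unfold circle, Re, Im; simpl; auto_derive; auto; ring.
Qed.

(** Since the angular velocity of the circle is i times its position, the
    angular derivative of [Im H] is [r] times the radial derivative of [Re H]:
    the Cauchy-Riemann equations in polar coordinates. *)
Lemma is_derive_angular (H : C -> C) (l : C) (r theta : R) :
  is_Cderive H (circle r theta) l ->
  is_derive (fun v => Re (H (circle r v))) theta (- (r * Im (l * circle 1 theta))) /\
  is_derive (fun v => Im (H (circle r v))) theta (r * Re (l * circle 1 theta)).
Proof.
  intros HH.
  destruct (is_derive_along_path H (circle r) theta l (Ci * circle r theta) HH) as [H1 H2].
  1,2: unfold circle, Re, Im; simpl; auto_derive; auto; ring.
  replace (- (r * Im (l * circle 1 theta))) with (Re (l * (Ci * circle r theta)))
    by (unfold circle, Re, Im; simpl; ring).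
  replace (r * Re (l * circle 1 theta)) with (Im (l * (Ci * circle r theta)))
    by (unfold circle, Re, Im; simpl; ring).
  auto.
Qed.

(** The integral [F x] over the circle of radius [x] has derivative the integral
    of the radial derivative of [Re H], which by the Cauchy-Riemann equations is
    [/ x] times the integral of the angular derivative of [Im H], zero over a
    full turn. So [F] is constant on [0, r], and [F 0] is immediate. *)
Lemma circle_mean_value (H : C -> C) (r : R) :
  C1_on_disk H -> 0 <= r < 1 ->
  is_RInt (fun theta => Re (H (circle r theta))) 0 (2 * PI) (2 * PI * Re (H 0)).
Proof.
  intros [H' HH] Hr.
  set (F := fun x => RInt (fun theta => Re (H (circle x theta))) 0 (2 * PI)).
  assert (Hex : forall x, Rabs x < 1 ->
    ex_RInt (fun theta => Re (H (circle x theta))) 0 (2 * PI)).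
  { intros x Hx. apply (@ex_RInt_continuous R_CompleteNormedModule). intros t _.
    apply (@ex_derive_continuous R_AbsRing R_NormedModule).
    assert (Hd := proj1 (HH _ (disk_circle x t Hx))).
    destruct (is_derive_angular H _ x t Hd) as [H1 _].
    eexists. exact H1. }
  assert (Hcont : forall x t, Rabs x < 1 ->
    continuity_2d_pt (fun u v => Re (H' (circle u v) * circle 1 v)) x t).
  { intros x t Hx. apply continuity_2d_pt_filterlim.
    apply (@continuous_comp R2_space C_abs_space R_UniformSpace
      (fun p => H' (circle (fst p) (snd p)) * circle 1 (snd p))%C Re (x, t));
      [|apply continuous_Re].
    apply (@continuous_mult R2_space C_AbsRing).
    - apply (@continuous_comp R2_space C_abs_space C_abs_space
        (fun p => circle (fst p) (snd p)) H').
      + apply continuous_circle.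
      + now apply HH, disk_circle.
    - apply (@continuous_comp R2_space R2_space C_abs_space
        (fun p => (1, snd p)) (fun p => circle (fst p) (snd p))).
      + apply (continuous_to_pair _ _ _ (fun _ => 1) snd).
        * apply continuous_const.
        * apply continuous_snd.
      + apply continuous_circle. }
  assert (Hnear : forall x, Rabs x < 1 -> locally x (fun y => Rabs y < 1)).
  { intros x Hx. apply (open_comp Rabs (fun y => y < 1)); auto.
    - intros y _. apply continuous_Rabs.
    - apply open_lt. }
  assert (HF : forall x, Rabs x < 1 -> is_derive F x
     (RInt (fun t => Re (H' (circle x t) * circle 1 t)) 0 (2 * PI))).
  { intros x Hx.
    assert (HD : forall u v, Rabs u < 1 ->
      Derive (fun z => Re (H (circle z v))) u = Re (H' (circle u v) * circle 1 v)).
    { intros u v Hu. apply is_derive_unique.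
      exact (is_derive_radial H _ u v (proj1 (HH _ (disk_circle u v Hu)))). }
    rewrite (RInt_ext _ (fun t => Derive (fun u => Re (H (circle u t))) x))
      by (intros; now rewrite HD).
    apply (is_derive_RInt_param (fun u t => Re (H (circle u t)))).
    - generalize (Hnear x Hx). apply filter_imp. intros y Hy t _.
      eexists. exact (is_derive_radial H _ y t (proj1 (HH _ (disk_circle y t Hy)))).
    - intros t _. eapply continuity_2d_pt_ext_loc; [|apply (Hcont x t Hx)].
      destruct (Hnear x Hx) as [d Hd]. exists d. intros u v Hu Hv. symmetry. now apply HD, Hd.
    - generalize (Hnear x Hx). apply filter_imp. exact Hex. }
  assert (HF0 : forall x, Rabs x < 1 -> x <> 0 -> is_derive F x 0).
  { intros x Hx Hx0.
    replace 0 with (RInt (fun t => Re (H' (circle x t) * circle 1 t)) 0 (2 * PI));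
      [now apply HF|].
    apply is_RInt_unique.
    replace 0 with (/ x * (Im (H (circle x (2 * PI))) - Im (H (circle x 0)))) at 2.
    - apply (is_RInt_ext (fun t => / x * (x * Re (H' (circle x t) * circle 1 t)))).
      { intros t _. match goal with |- ?a = ?b => change (@eq R a b) end. field. exact Hx0. }
      apply (@is_RInt_scal R_NormedModule).
      apply (is_RInt_derive (fun t => Im (H (circle x t)))).
      + intros t _.
        exact (proj2 (is_derive_angular H _ x t (proj1 (HH _ (disk_circle x t Hx))))).
      + intros t _. apply (@continuous_scal_r R_UniformSpace R_AbsRing R_NormedModule).
        apply (@continuous_comp R_UniformSpace R2_space R_UniformSpace
          (fun t => (x, t)) (fun p => Re (H' (circle (fst p) (snd p)) * circle 1 (snd p)))).
        * apply (continuous_to_pair _ _ _ (fun _ => x) (fun t => t));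
            [apply continuous_const|apply continuous_id].
        * exact (proj1 (continuity_2d_pt_filterlim _ x t) (Hcont x t Hx)).
    - unfold circle. rewrite cos_2PI, sin_2PI, cos_0, sin_0. ring. }
  assert (Hconst : F r = F 0).
  { destruct (Rle_lt_or_eq_dec 0 r (proj1 Hr)) as [Hr0|<-]; [|reflexivity].
    destruct (MVT_gen F 0 r (fun _ => 0)) as (c & _ & Hc).
    - rewrite Rmin_left, Rmax_right by lra. intros x Hx. apply HF0; [rewrite Rabs_pos_eq|]; lra.
    - rewrite Rmin_left, Rmax_right by lra. intros x Hx.
      apply continuity_pt_filterlim.
      apply (@ex_derive_continuous R_AbsRing R_NormedModule).
      eexists. apply HF. rewrite Rabs_pos_eq; lra.
    - lra. }
  replace (2 * PI * Re (H 0)) with (F r).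
  - apply (@RInt_correct R_CompleteNormedModule), Hex. rewrite Rabs_pos_eq; lra.
  - rewrite Hconst. unfold F.
    rewrite (RInt_ext _ (fun _ => Re (H 0))).
    + rewrite RInt_const. unfold scal; simpl; unfold mult; simpl. ring.
    + intros t _. unfold circle. now rewrite !Rmult_0_l.
Qed.

(** * Parseval's identity for polynomials *)

Notation Csum_n f N := (@sum_n C_AbelianMonoid f N).

Definition Cpoly (d : nat -> C) (N : nat) (z : C) : C :=
  Csum_n (fun k => d k * z ^ k)%C N.

(** On the circle of radius [r] the conjugate of [z ^ k] is [r ^ (2 * k) / z ^ k],
    so there the conjugate of the polynomial [Cpoly d N] times [z ^ M] agrees
    with this polynomial. It turns cross terms of squared moduli into real parts
    of holomorphic functions, to which the mean value property applies. *)
Definition reflected_poly (d : nat -> C) (N M : nat) (r : R) (z : C) : C :=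
  Csum_n (fun k => Cconj (d k) * RtoC (r ^ (2 * k)) * z ^ (M - k))%C N.

Lemma Csum_n_Sn (u : nat -> C) (N : nat) :
  Csum_n u (S N) = (Csum_n u N + u (S N))%C.
Proof. exact (@sum_Sn C_AbelianMonoid u N). Qed.

Lemma reflected_poly_C1 (d : nat -> C) (N M : nat) (r : R) :
  C1_on_disk (reflected_poly d N M r).
Proof.
  apply (C1_on_disk_sum (fun k z => Cconj (d k) * RtoC (r ^ (2 * k)) * z ^ (M - k))%C). intros k.
  apply C1_on_disk_mult; [apply C1_on_disk_const|apply C1_on_disk_pow].
Qed.

Lemma reflected_poly_0 (d : nat -> C) (N M : nat) (r : R) :
  (N < M)%nat -> reflected_poly d N M r 0 = 0.
Proof.
  unfold reflected_poly. induction N as [|N IH]; intros HM.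
  - rewrite sum_O. destruct M as [|M]; [lia|]. simpl. ring.
  - rewrite Csum_n_Sn, IH by lia.
    replace (M - S N)%nat with (S (M - S (S N))) by lia. rewrite Cpow_S. ring.
Qed.

Lemma Cconj_Cpoly_circle (d : nat -> C) (N M : nat) (z : C) :
  (N <= M)%nat -> (Cconj (Cpoly d N z) * z ^ M)%C = reflected_poly d N M (Cmod z) z.
Proof.
  assert (H : forall k, (k <= M)%nat ->
    (Cconj (d k * z ^ k) * z ^ M = Cconj (d k) * RtoC (Cmod z ^ (2 * k)) * z ^ (M - k))%C).
  { intros k Hk. rewrite Cmult_conj, Cpow_conj.
    replace (z ^ M)%C with (z ^ k * z ^ (M - k))%C
      by (rewrite <- Cpow_add_r; f_equal; lia).
    rewrite pow_mult, RtoC_pow, Cmod2_conj, Cpow_mult_l. ring. }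
  unfold Cpoly, reflected_poly. induction N as [|N IH]; intros HM.
  - rewrite !sum_O. apply H; lia.
  - rewrite !Csum_n_Sn, Cplus_conj, Cmult_plus_distr_r, IH, H by lia. reflexivity.
Qed.

Lemma Cmod2_plus (u v : C) :
  Cmod (u + v) ^ 2 = Cmod u ^ 2 + Cmod v ^ 2 + 2 * Re (Cconj u * v).
Proof. rewrite !Cmod2_alt. destruct u, v; unfold Re, Im; simpl; ring. Qed.

(** Adding the monomial of degree [S N] creates the cross term
    [2 * Re (Cconj (Cpoly d N z) * d (S N) * z ^ S N)], which on the circle is
    the real part of a polynomial vanishing at 0, so it integrates to 0. *)
Lemma Parseval_Cpoly (d : nat -> C) (N : nat) (r : R) :
  0 <= r < 1 ->
  is_RInt (fun theta => Cmod (Cpoly d N (circle r theta)) ^ 2) 0 (2 * PI)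
    (2 * PI * sum_n (fun k => Cmod (d k) ^ 2 * r ^ (2 * k)) N).
Proof.
  intros Hr.
  assert (Hmod : forall theta, Cmod (circle r theta) = r).
  { intros theta. rewrite Cmod_circle. apply Rabs_pos_eq; lra. }
  induction N as [|N IH].
  - rewrite sum_O. unfold Cpoly.
    apply (is_RInt_ext (fun _ => Cmod (d 0%nat) ^ 2)).
    { intros theta _. rewrite sum_O. f_equal. f_equal. simpl. ring. }
    replace (2 * PI * (Cmod (d 0%nat) ^ 2 * r ^ (2 * 0)))
      with (scal (2 * PI - 0) (Cmod (d 0%nat) ^ 2)).
    + apply (@is_RInt_const R_NormedModule).
    + Rops. simpl. ring.
  - set (T := fun z => (reflected_poly d N (S N) r z * d (S N))%C).
    assert (HT : C1_on_disk T).
    { apply C1_on_disk_mult; [apply reflected_poly_C1|apply C1_on_disk_const]. }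
    assert (HT0 : Re (T 0) = 0).
    { unfold T. rewrite reflected_poly_0 by lia. simpl. ring. }
    assert (HI := circle_mean_value T r HT Hr). rewrite HT0 in HI.
    rewrite sum_Sn. Rops.
    apply (is_RInt_ext (fun theta => Cmod (Cpoly d N (circle r theta)) ^ 2
      + (2 * Re (T (circle r theta)) + Cmod (d (S N)) ^ 2 * r ^ (2 * S N)))).
    { intros theta _. unfold Cpoly at 2. rewrite Csum_n_Sn. fold (Cpoly d N (circle r theta)).
      rewrite Cmod2_plus. unfold T.
      rewrite <- (Hmod theta) at 2.
      rewrite <- Cconj_Cpoly_circle by lia.
      rewrite Cmod_mult, Cmod_pow, Hmod, Rpow_mult_distr, <- pow_mult.
      rewrite (Nat.mul_comm (S N) 2).
      replace (Cconj (Cpoly d N (circle r theta)) * circle r theta ^ S N * d (S N))%C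
        with (Cconj (Cpoly d N (circle r theta)) * (d (S N) * circle r theta ^ S N))%C by ring.
      Rops. ring. }
    rewrite Rmult_plus_distr_l.
    apply (@is_RInt_plus R_NormedModule); [exact IH|].
    replace (2 * PI * (Cmod (d (S N)) ^ 2 * r ^ (2 * S N))) with
      (plus (scal 2 (2 * PI * 0)) (scal (2 * PI - 0) (Cmod (d (S N)) ^ 2 * r ^ (2 * S N)))).
    + apply (@is_RInt_plus R_NormedModule).
      * now apply (@is_RInt_scal R_NormedModule).
      * apply (@is_RInt_const R_NormedModule).
    + Rops. ring.
Qed.

(** * Clunie's inequality *)

Lemma pseries_shift (d : nat -> C) (P : C -> C) :
  (forall z, disk z -> is_Cpseries d z (P z)) ->
  exists G : C -> C,
    (forall z, disk z -> is_Cpseries (fun k => d (S k)) z (G z)) /\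
    (forall z, disk z -> P z = (d 0%nat + z * G z)%C).
Proof.
  intros HP.
  (* At 0 the quotient is its limit, the next coefficient. *)
  exists (fun z => if Ceq_dec z 0 then d 1%nat else (/ z * (P z - d 0%nat))%C).
  split; intros z Hz; destruct (Ceq_dec z 0) as [->|Hz0].
  - apply (@is_pseries_0 C_AbsRing C_NormedModule).
  - apply (@is_pseries_decr_1 C_AbsRing C_NormedModule d z (/ z)%C (P z)); auto.
    now apply Cinv_l.
  - assert (H := HP (RtoC 0) Hz).
    rewrite <- (filterlim_locally_unique _ _ _ (@is_pseries_0 C_AbsRing C_NormedModule d) H).
    ring.
  - field. exact Hz0.
Qed.

Lemma pseries_remainder (d : nat -> C) (P : C -> C) (N : nat) :
  (forall z, disk z -> is_Cpseries d z (P z)) ->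
  exists G : C -> C, C1_on_disk G /\
    forall z, disk z -> P z = (Cpoly d N z + z ^ S N * G z)%C.
Proof.
  intros HP.
  assert (H : exists G : C -> C,
    (forall z, disk z -> is_Cpseries (fun k => d (S N + k)%nat) z (G z)) /\
    forall z, disk z -> P z = (Cpoly d N z + z ^ S N * G z)%C).
  { induction N as [|N (G & HG & HPG)].
    - destruct (pseries_shift d P HP) as (G & HG & HPG). exists G. split; [exact HG|].
      intros z Hz. rewrite (HPG z Hz). unfold Cpoly. rewrite sum_O. simpl. ring.
    - destruct (pseries_shift _ G HG) as (G1 & HG1 & HGG1). exists G1. split.
      + intros z Hz. specialize (HG1 z Hz). revert HG1. apply is_pseries_ext.
        intros n. f_equal. lia.
      + intros z Hz. rewrite (HPG z Hz), (HGG1 z Hz). unfold Cpoly. rewrite Csum_n_Sn.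
        rewrite Nat.add_0_r, !Cpow_S. ring. }
  destruct H as (G & HG & HPG). exists G. split; auto.
  now apply pseries_C1_on_disk with (1 := HG).
Qed.

Lemma continuous_le_left (f : R -> R) (M : R) :
  continuous f 1 -> (forall r, 0 <= r < 1 -> f r <= M) -> f 1 <= M.
Proof.
  intros Hc HM. destruct (Rle_lt_dec (f 1) M) as [|Hlt]; auto. exfalso.
  assert (He : 0 < f 1 - M) by lra.
  destruct (Hc _ (locally_ball (f 1) (mkposreal _ He))) as [d Hd].
  assert (Hd0 := cond_pos d).
  set (r := Rmax 0 (1 - d / 2)).
  assert (Hr : 0 <= r < 1) by (unfold r; split; [apply Rmax_l|apply Rmax_lub_lt; lra]).
  assert (Hr2 : 1 - d / 2 <= r) by apply Rmax_r.
  specialize (HM r Hr).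
  assert (Hb : ball 1 d r).
  { change (Rabs (r - 1) < d). apply Rabs_def1; lra. }
  specialize (Hd r Hb). change (Rabs (f r - f 1) < f 1 - M) in Hd.
  apply Rabs_def2 in Hd. lra.
Qed.

(** Write S_n for the partial sum of degree n of [P]. Replacing [P] by S_N on the
    right of [P = phi * (c - b * P)] changes only terms of order above [N]:
    [phi * (c - b * S_N) = S_(N+1) + z ^ (N+1) * K] with [K] holomorphic and
    vanishing at 0. On a circle of radius [r] the squared modulus of the left
    side is at most that of [c - b * S_N], while that of the right side is at
    least that of S_(N+1) plus a cross term of mean zero. Parseval's identity
    on both sides and [r -> 1] give the claim. Working with the cross term
    avoids the expansion of [phi] in a power series on the whole disk. *)
Theorem Clunie_inequality (phi P : C -> C) (d : nat -> C) (c b : C) (N : nat) :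
  C1_on_disk phi -> phi 0 = 0 -> (forall z, disk z -> Cmod (phi z) <= 1) ->
  (forall z, disk z -> is_Cpseries d z (P z)) -> d 0%nat = 0 ->
  (forall z, disk z -> P z = (phi z * (c - b * P z))%C) ->
  sum_n (fun k => Cmod (d k) ^ 2) (S N) <=
  Cmod c ^ 2 + Cmod b ^ 2 * sum_n (fun k => Cmod (d k) ^ 2) N.
Proof.
  intros Hphi Hphi0 Hphi1 HP Hd0 Heq.
  (* The coefficients of c - b S_N, where d 0 = 0 leaves c as constant term. *)
  set (e := fun k => match k with 0%nat => c | _ => (- (b * d k))%C end).
  assert (He : forall z, (c - b * Cpoly d N z)%C = Cpoly e N z).
  { intros z. unfold Cpoly. induction N as [|n IH].
    - rewrite !sum_O, Hd0. simpl. ring.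
    - rewrite !Csum_n_Sn, <- IH. unfold e. ring. }
  assert (HeS : sum_n (fun k => Cmod (e k) ^ 2) N =
     Cmod c ^ 2 + Cmod b ^ 2 * sum_n (fun k => Cmod (d k) ^ 2) N).
  { clear He. induction N as [|n IH].
    - rewrite !sum_O, Hd0, Cmod_0. simpl. ring.
    - rewrite !sum_Sn, IH. Rops.
      unfold e. rewrite Cmod_opp, Cmod_mult. ring. }
  rewrite <- HeS.
  destruct (pseries_remainder d P N HP) as (G1 & HG1 & HPG1).
  destruct (pseries_remainder d P (S N) HP) as (G2 & HG2 & HPG2).
  set (K := fun z => (z * G2 z + b * (phi z * G1 z))%C).
  assert (HK : C1_on_disk K).
  { apply C1_on_disk_plus; apply C1_on_disk_mult.
    - apply C1_on_disk_id.
    - exact HG2.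
    - apply C1_on_disk_const.
    - now apply C1_on_disk_mult. }
  assert (Hh : forall z, disk z ->
    (phi z * Cpoly e N z = Cpoly d (S N) z + z ^ S N * K z)%C).
  { intros z Hz. rewrite <- He. unfold K.
    assert (E1 := HPG1 z Hz). assert (E2 := HPG2 z Hz). assert (E := Heq z Hz).
    replace (Cpoly d N z) with (P z - z ^ S N * G1 z)%C by (rewrite E1; ring).
    replace (Cpoly d (S N) z) with (P z - z ^ S (S N) * G2 z)%C by (rewrite E2; ring).
    replace (phi z * (c - b * (P z - z ^ S N * G1 z)))%C with
      (phi z * (c - b * P z) + b * phi z * (z ^ S N * G1 z))%C by ring.
    rewrite <- E, !Cpow_S. ring. }
  assert (Hcirc : forall r, 0 <= r < 1 ->
    sum_n (fun k => Cmod (d k) ^ 2 * r ^ (2 * k)) (S N) <=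
    sum_n (fun k => Cmod (e k) ^ 2 * r ^ (2 * k)) N).
  { intros r Hr.
    set (T := fun z => (reflected_poly d (S N) (S N) r z * K z)%C).
    assert (HT : C1_on_disk T).
    { apply C1_on_disk_mult; [apply reflected_poly_C1|exact HK]. }
    assert (HT0 : Re (T 0) = 0).
    { unfold T, K. rewrite Hphi0.
      replace (_ * _)%C with (RtoC 0) by ring. reflexivity. }
    assert (HI := circle_mean_value T r HT Hr). rewrite HT0 in HI.
    assert (Hlhs := @is_RInt_plus R_NormedModule _ _ _ _ _ _
       (Parseval_Cpoly d (S N) r Hr) (@is_RInt_scal R_NormedModule _ _ _ 2 _ HI)).
    assert (HPI := PI_RGT_0).
    assert (Hle : 2 * PI * sum_n (fun k => Cmod (d k) ^ 2 * r ^ (2 * k)) (S N) + 2 * (2 * PI * 0)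
      <= 2 * PI * sum_n (fun k => Cmod (e k) ^ 2 * r ^ (2 * k)) N).
    { apply (is_RInt_le _ _ 0 (2 * PI) _ _ ltac:(lra) Hlhs (Parseval_Cpoly e N r Hr)).
      intros theta _. set (z := circle r theta).
      assert (Hz : disk z) by (apply disk_circle; rewrite Rabs_pos_eq; lra).
      assert (Hzr : Cmod z = r) by (unfold z; rewrite Cmod_circle, Rabs_pos_eq; lra).
      change (Cmod (Cpoly d (S N) z) ^ 2 + 2 * Re (T z) <= Cmod (Cpoly e N z) ^ 2).
      apply Rle_trans with (Cmod (phi z * Cpoly e N z) ^ 2).
      - rewrite (Hh z Hz), Cmod2_plus. unfold T.
        rewrite <- Hzr at 1. rewrite <- Cconj_Cpoly_circle by lia.
        rewrite Cmult_assoc. assert (H := pow2_ge_0 (Cmod (z ^ S N * K z))). lra.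
      - apply pow_incr. split; [apply Cmod_ge_0|]. rewrite Cmod_mult.
        assert (H1 := Hphi1 z Hz). assert (H2 := Cmod_ge_0 (Cpoly e N z)). nra. }
    nra. }
  replace (sum_n (fun k => Cmod (d k) ^ 2) (S N)) with
    ((fun r => sum_n (fun k => Cmod (d k) ^ 2 * r ^ (2 * k)) (S N)) 1).
  - apply (continuous_le_left (fun r => sum_n (fun k => Cmod (d k) ^ 2 * r ^ (2 * k)) (S N))).
    + apply (@ex_derive_continuous R_AbsRing R_NormedModule).
      generalize (S N). intros n. induction n as [|n IH].
      * apply (ex_derive_ext (fun r => Cmod (d 0%nat) ^ 2 * r ^ (2 * 0))).
        { intros r. now rewrite sum_O. }
        auto_derive; auto.
      * apply (ex_derive_ext (fun r => sum_n (fun k => Cmod (d k) ^ 2 * r ^ (2 * k)) n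
           + Cmod (d (S n)) ^ 2 * r ^ (2 * S n))).
        { intros r. now rewrite sum_Sn. }
        apply (@ex_derive_plus R_AbsRing R_NormedModule); [exact IH|].
        auto_derive; auto.
    + intros r Hr. eapply Rle_trans; [now apply Hcirc|].
      apply sum_n_m_le. intros k.
      assert (Hp : r ^ (2 * k) <= 1).
      { rewrite <- (pow1 (2 * k)). apply pow_incr; lra. }
      assert (H := pow2_ge_0 (Cmod (e k))). nra.
  - apply sum_n_ext. intros k. rewrite pow1. Rops. ring.
Qed.

(** * The equation for the logarithmic derivative *)

(** Complex derivatives are determined along the real direction, so the identity
    follows by differentiating [z * Cexp (L z)] in real coordinates on the
    segment [z + u]. *)
Lemma derive_mult_Cexp (f L : C -> C) (z f' L' : C) :
  disk z -> z <> 0 ->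
  (forall w, disk w -> w <> 0 -> f w = (w * Cexp (L w))%C) ->
  is_Cderive f z f' -> is_Cderive L z L' ->
  f' = (Cexp (L z) * (1 + z * L'))%C.
Proof.
  intros Hz Hz0 Hf Hf' HL'.
  set (g := fun u => (z + RtoC u)%C).
  assert (Hg0 : g 0 = z) by (unfold g; ring).
  assert (Hgre : is_derive (fun u => Re (g u)) 0 (Re 1)).
  { unfold g, Re; simpl. auto_derive; auto; ring. }
  assert (Hgim : is_derive (fun u => Im (g u)) 0 (Im 1)).
  { unfold g, Im; simpl. auto_derive; auto; ring. }
  rewrite <- Hg0 in Hf', HL'.
  destruct (is_derive_along_path f g 0 f' 1 Hf' Hgre Hgim) as [Hfre Hfim].
  destruct (is_derive_along_path L g 0 L' 1 HL' Hgre Hgim) as [HLre HLim].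
  rewrite Cmult_1_r in Hfre, Hfim, HLre, HLim.
  assert (Hloc : locally 0 (fun u => (g u * Cexp (L (g u)) = f (g u))%C)).
  { assert (Hd : 0 < Rmin (1 - Cmod z) (Cmod z)).
    { apply Rmin_pos; [unfold disk in Hz; lra|now apply Cmod_gt_0]. }
    exists (mkposreal _ Hd). intros u Hu. change (Rabs (u - 0) < Rmin (1 - Cmod z) (Cmod z)) in Hu.
    rewrite Rminus_0_r in Hu.
    assert (Hu1 := Rlt_le_trans _ _ _ Hu (Rmin_l _ _)).
    assert (Hu2 := Rlt_le_trans _ _ _ Hu (Rmin_r _ _)).
    symmetry. apply Hf.
    - unfold disk, g. eapply Rle_lt_trans; [apply Cmod_triangle|]. rewrite Cmod_R. lra.
    - intros E. assert (Ez : z = (- RtoC u)%C).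
      { replace z with (g u - RtoC u)%C by (unfold g; ring). rewrite E. ring. }
      rewrite Ez, Cmod_opp, Cmod_R in Hu2. lra. }
  pose (p := fun u => Re (L (g u))). pose (q := fun u => Im (L (g u))).
  change (is_derive p 0 (Re L')) in HLre. change (is_derive q 0 (Im L')) in HLim.
  assert (Ep : p 0 = Re (L z)) by (unfold p; now rewrite Hg0).
  assert (Eq : q 0 = Im (L z)) by (unfold q; now rewrite Hg0).
  assert (Dp := is_derive_unique _ _ _ HLre). assert (Dq := is_derive_unique _ _ _ HLim).
  assert (Xp : ex_derive p 0) by (eexists; exact HLre).
  assert (Xq : ex_derive q 0) by (eexists; exact HLim).
  assert (H1 : is_derive (fun u =>
    (Re z + u) * (exp (p u) * cos (q u)) - Im z * (exp (p u) * sin (q u))) 0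
     (Re (Cexp (L z) * (1 + z * L')))).
  { auto_derive; [auto|].
    change (Derive (fun x => p x) 0) with (Derive p 0).
    change (Derive (fun x => q x) 0) with (Derive q 0).
    rewrite Dp, Dq, Ep, Eq. unfold Cexp, Re, Im; simpl. ring. }
  assert (H2 : is_derive (fun u =>
    (Re z + u) * (exp (p u) * sin (q u)) + Im z * (exp (p u) * cos (q u))) 0
     (Im (Cexp (L z) * (1 + z * L')))).
  { auto_derive; [auto|].
    change (Derive (fun x => p x) 0) with (Derive p 0).
    change (Derive (fun x => q x) 0) with (Derive q 0).
    rewrite Dp, Dq, Ep, Eq. unfold Cexp, Re, Im; simpl. ring. }
  assert (E1 : Re f' = Re (Cexp (L z) * (1 + z * L'))).
  { rewrite <- (is_derive_unique _ _ _ Hfre). apply is_derive_unique.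
    revert H1. apply is_derive_ext_loc. revert Hloc. apply filter_imp. intros u <-.
    unfold p, q, Cexp, g, Re, Im; simpl. ring. }
  assert (E2 : Im f' = Im (Cexp (L z) * (1 + z * L'))).
  { rewrite <- (is_derive_unique _ _ _ Hfim). apply is_derive_unique.
    revert H2. apply is_derive_ext_loc. revert Hloc. apply filter_imp. intros u <-.
    unfold p, q, Cexp, g, Re, Im; simpl. ring. }
  rewrite (surjective_pairing f'), (surjective_pairing (Cexp (L z) * _)%C).
  unfold Re in E1. unfold Im in E2. now rewrite E1, E2.
Qed.

Lemma starlike_quotient_log_branch (f L : C -> C) (z : C) :
  analytic_on_disk f -> (forall z, disk z -> z <> 0 -> f z <> 0) ->
  log_branch f L -> disk z ->
  starlike_quotient f z = (1 + z * C_derive L z)%C.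
Proof.
  intros Hf Hf0 (HL & _ & Hexp) Hz. unfold starlike_quotient.
  destruct (Ceq_dec z 0) as [->|Hz0]; [ring|].
  assert (HE : forall w, disk w -> w <> 0 -> f w = (w * Cexp (L w))%C).
  { intros w Hw Hw0. rewrite (Hexp w Hw Hw0). field. exact Hw0. }
  rewrite (derive_mult_Cexp f L z (C_derive f z) (C_derive L z) Hz Hz0 HE).
  - assert (Hfz := Hf0 z Hz Hz0). rewrite (Hexp z Hz Hz0). field. auto.
  - now apply analytic_is_Cderive, Hf.
  - now apply analytic_is_Cderive, HL.
Qed.

Definition log_derivative_coef (gamma : nat -> C) (n : nat) : C :=
  (2 * RtoC (INR n) * gamma n)%C.

Lemma log_derivative_pseries (L : C -> C) (gamma : nat -> C) :
  (forall z, disk z -> exists s,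
     is_Cseries (fun n => gamma (S n) * z ^ (S n))%C s /\
     L z = (2 * s)%C) ->
  forall z, disk z ->
  is_Cpseries (log_derivative_coef gamma) z (z * C_derive L z)%C.
Proof.
  intros Hg.
  set (a := fun n => match n with 0%nat => RtoC 0 | _ => (2 * gamma n)%C end).
  assert (Ha : forall z, disk z -> is_Cpseries a z (L z)).
  { intros z Hz. destruct (Hg z Hz) as (s & Hs & ->).
    apply (@is_series_decr_1 C_AbsRing C_NormedModule).
    replace (plus _ _) with (2 * s)%C.
    - apply (@is_series_scal C_AbsRing C_NormedModule (RtoC 2)) in Hs. revert Hs.
      apply is_series_ext. intros n.
      change (2 * (gamma (S n) * z ^ S n) = z ^ S n * (2 * gamma (S n)))%C. ring.
    - change (2 * s = 2 * s + - (1 * 0))%C. ring. }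
  intros z Hz.
  destruct (pseries_C1_at a L 1 Ha z Hz) as (_ & _ & H).
  apply (@is_pseries_incr_1 C_AbsRing C_NormedModule) in H. revert H.
  apply is_pseries_ext. intros [|n]; unfold PS_incr_1, pseries_derive, log_derivative_coef, a.
  - change (RtoC 0 = 2 * 0 * gamma 0%nat)%C. ring.
  - change (RtoC (INR (S n)) * (2 * gamma (S n)) = 2 * RtoC (INR (S n)) * gamma (S n))%C. ring.
Qed.

(** With [P = z * L'] the subordination reads
    [1 + P = (1 + A phi) / (1 + B phi)]; clearing the denominator, which does not
    vanish because [Rabs B <= 1] and [Cmod (phi z) < 1], puts it in the form of
    Clunie's inequality. *)
Lemma subordination_equation (A B : R) (f L phi : C -> C) (z : C) :
  -1 <= B <= 1 ->
  analytic_on_disk f -> (forall z, disk z -> z <> 0 -> f z <> 0) ->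
  log_branch f L -> disk z -> Cmod (phi z) < 1 ->
  starlike_quotient f z = ((1 + RtoC A * phi z) / (1 + RtoC B * phi z))%C ->
  (z * C_derive L z = phi z * (RtoC (A - B) - RtoC B * (z * C_derive L z)))%C.
Proof.
  intros HB Hf Hf0 HL Hz Hphi E.
  rewrite (starlike_quotient_log_branch f L z Hf Hf0 HL Hz) in E.
  assert (Hden : (1 + RtoC B * phi z)%C <> 0).
  { intros H0. assert (H1 : (RtoC B * phi z)%C = (- (1))%C).
    { replace (RtoC B * phi z)%C with ((1 + RtoC B * phi z) - 1)%C by ring. rewrite H0. ring. }
    apply (f_equal Cmod) in H1. rewrite Cmod_mult, Cmod_m1, Cmod_R in H1.
    assert (Rabs B <= 1) by (apply Rabs_le; lra).
    assert (H2 := Rabs_pos B). assert (H3 := Cmod_ge_0 (phi z)). nra. }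
  set (P := (z * C_derive L z)%C) in *.
  assert (E' : ((1 + P) * (1 + RtoC B * phi z) = 1 + RtoC A * phi z)%C).
  { rewrite E. field. exact Hden. }
  rewrite RtoC_minus.
  replace P with ((1 + P) * (1 + RtoC B * phi z) - 1 - RtoC B * phi z * (1 + P))%C at 1 by ring.
  rewrite E'. ring.
Qed.

(** * Weighted comparison of the coefficients *)

(** Summation by parts: nonincreasing nonnegative weights preserve an inequality
    between all partial sums. The induction carries the boundary term
    [w N * (sum_n b N - sum_n a N)]. *)
Lemma weighted_sum_le (w a b : nat -> R) :
  (forall n, 0 <= w n) -> (forall n, w (S n) <= w n) ->
  (forall N, sum_n a N <= sum_n b N) ->
  forall N, sum_n (fun n => w n * a n) N <= sum_n (fun n => w n * b n) N.
Proof.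
  intros Hw Hdec Hab N.
  assert (H : w N * (sum_n b N - sum_n a N) <=
    sum_n (fun n => w n * b n) N - sum_n (fun n => w n * a n) N).
  { induction N as [|N IH].
    - rewrite !sum_O. lra.
    - rewrite !sum_Sn. Rops. specialize (Hab N). specialize (Hdec N). nra. }
  specialize (Hw N). specialize (Hab N). nra.
Qed.

(** The weight is a constant times [((x + 1) / x) ^ 2 * Rpower (x + 1) (t - 2)],
    and both factors are nonincreasing in [x] when [t <= 2]. The factor 4 comes
    from [Cmod (gamma n) ^ 2 = Cmod (2 n gamma n) ^ 2 / (4 n ^ 2)]. *)
Lemma weight_decreasing (t x : R) :
  t <= 2 -> 0 < x ->
  Rpower (x + 1 + 1) t / (4 * (x + 1) ^ 2) <= Rpower (x + 1) t / (4 * x ^ 2).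
Proof.
  intros Ht Hx.
  assert (Hsplit : forall y, 0 < y -> Rpower y t = y ^ 2 * Rpower y (t - 2)).
  { intros y Hy. rewrite <- (Rpower_pow 2 y Hy), <- Rpower_plus. f_equal. simpl. ring. }
  rewrite !Hsplit by lra.
  assert (Hp : Rpower (x + 1 + 1) (t - 2) <= Rpower (x + 1) (t - 2)).
  { unfold Rpower. assert (Hln : ln (x + 1) <= ln (x + 1 + 1)).
    { left. apply ln_increasing; lra. }
    destruct (Req_dec ((t - 2) * ln (x + 1 + 1)) ((t - 2) * ln (x + 1))) as [->|Hne].
    - lra.
    - left. apply exp_increasing. nra. }
  assert (Hp0 : 0 < Rpower (x + 1 + 1) (t - 2)) by apply exp_pos.
  replace ((x + 1 + 1) ^ 2 * Rpower (x + 1 + 1) (t - 2) / (4 * (x + 1) ^ 2)) with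
    (((x + 1 + 1) / (x + 1)) ^ 2 / 4 * Rpower (x + 1 + 1) (t - 2)) by (field; lra).
  replace ((x + 1) ^ 2 * Rpower (x + 1) (t - 2) / (4 * x ^ 2)) with
    (((x + 1) / x) ^ 2 / 4 * Rpower (x + 1) (t - 2)) by (field; lra).
  assert (Hq0 : 0 < (x + 1 + 1) / (x + 1)) by (apply Rdiv_lt_0_compat; lra).
  assert (Hq : (x + 1 + 1) / (x + 1) <= (x + 1) / x).
  { apply (Rmult_le_reg_r (x * (x + 1))); [nra|].
    replace ((x + 1 + 1) / (x + 1) * (x * (x + 1))) with ((x + 1 + 1) * x) by (field; lra).
    replace ((x + 1) / x * (x * (x + 1))) with ((x + 1) * (x + 1)) by (field; lra). nra. }
  apply Rmult_le_compat; nra.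
Qed.

(** The geometric sums satisfy the recursion with equality. *)
Lemma sum_le_geometric (a : nat -> R) (c q : R) :
  q <> 0 -> a 0%nat = 0 ->
  (forall N, sum_n a (S N) <= c + q ^ 2 * sum_n a N) ->
  forall N, sum_n (fun n => a (S n)) N <= sum_n (fun n => c / q ^ 2 * q ^ (2 * S n)) N.
Proof.
  intros Hq Ha0 Ha.
  assert (Hshift : forall N, sum_n (fun n => a (S n)) N = sum_n a (S N)).
  { intros N. unfold sum_n at 2. rewrite sum_Sn_m by lia. rewrite <- sum_n_m_S, Ha0.
    symmetry. apply Rplus_0_l. }
  assert (Hgeo : forall N, sum_n (fun n => c / q ^ 2 * q ^ (2 * S n)) (S N) =
    c + q ^ 2 * sum_n (fun n => c / q ^ 2 * q ^ (2 * S n)) N).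
  { intros N. induction N as [|N IH].
    - rewrite sum_Sn, !sum_O. Rops. simpl. field. exact Hq.
    - rewrite (sum_Sn _ (S N)). rewrite IH at 1. rewrite (sum_Sn _ N). Rops.
      replace (2 * S (S (S N)))%nat with (2 + 2 * S (S N))%nat by lia.
      rewrite (pow_add q 2). ring. }
  intros N. induction N as [|N IH].
  - rewrite Hshift. eapply Rle_trans; [apply Ha|]. rewrite !sum_O, Ha0.
    right. simpl. field. exact Hq.
  - rewrite Hshift, Hgeo. eapply Rle_trans; [apply Ha|].
    rewrite <- Hshift.
    apply Rplus_le_compat_l, Rmult_le_compat_l; [apply pow2_ge_0|].
    exact IH.
Qed.

Theorem theorem2p4 (A B : R) (f : C -> C) (gamma : nat -> C) (t : R)
  (hB : -1 <= B) (hBA : B < A) (hA : A <= 1) (hB0 : B <> 0)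
  (hf : starlike_class A B f) (hgamma : log_coefficients f gamma)
  (ht : t <= 2) :
  Rbar_le
    (series_from_1 (fun n => Rpower (INR n + 1) t * Cmod (gamma n) ^ 2))
    (Rbar_mult (Finite (((A - B) / (2 * B)) ^ 2))
      (series_from_1
        (fun n => Rpower (INR n + 1) t / INR n ^ 2 * Rabs B ^ (2 * n)))).
Proof.
  destruct hf as ((Hf & _ & _) & Hf0 & (_ & _ & phi & Hphi & Hphi0 & Hphi1 & Hsub)).
  destruct hgamma as (L & HL & Hg).
  set (d := log_derivative_coef gamma).
  assert (Hclunie : forall N, sum_n (fun k => Cmod (d k) ^ 2) (S N) <=
    (A - B) ^ 2 + B ^ 2 * sum_n (fun k => Cmod (d k) ^ 2) N).
  { intros N.
    assert (H := Clunie_inequality phi (fun z => z * C_derive L z)%C d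
      (RtoC (A - B)) (RtoC B) N (analytic_on_disk_C1 _ Hphi) Hphi0
      (fun z Hz => Rlt_le _ _ (Hphi1 z Hz)) (log_derivative_pseries L gamma Hg)).
    rewrite !Cmod_R, !pow2_abs in H. apply H.
    - unfold d, log_derivative_coef. simpl INR. ring.
    - intros z Hz. apply (subordination_equation A B f); auto. lra. }
  assert (Hd0 : Cmod (d 0%nat) ^ 2 = 0).
  { unfold d, log_derivative_coef. simpl INR.
    replace (2 * RtoC 0 * gamma 0%nat)%C with (RtoC 0) by ring. rewrite Cmod_0. ring. }
  pose (w := fun n => Rpower (INR (S n) + 1) t / (4 * INR (S n) ^ 2)).
  assert (Hpos : forall n, 0 < INR (S n)) by (intros n; apply lt_0_INR; lia).
  assert (Hle := weighted_sum_le w _ _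
    ltac:(intros n; apply Rlt_le, Rdiv_lt_0_compat;
          [apply exp_pos|specialize (Hpos n); nra])
    ltac:(intros n; unfold w; rewrite (S_INR (S n)); now apply weight_decreasing)
    (sum_le_geometric _ ((A - B) ^ 2) B hB0 Hd0 Hclunie)).
  unfold series_from_1. rewrite <- Lim_seq_scal_l.
  apply Lim_seq_le_loc. exists 0%nat. intros [|N] _.
  - rewrite !sum_n_m_zero by lia. right. change (0 = ((A - B) / (2 * B)) ^ 2 * 0). ring.
  - rewrite <- !sum_n_m_S.
    eapply Rle_trans; [|eapply Rle_trans; [apply (Hle N)|]]; right.
    + apply sum_n_ext. intros n. unfold w, d, log_derivative_coef.
      rewrite !Cmod_mult, !Cmod_R, (Rabs_pos_eq 2), Rabs_pos_eq by (try apply pos_INR; lra).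
      specialize (Hpos n). Rops. field. lra.
    + eapply eq_trans; [|apply (@sum_n_mult_l R_Ring)].
      apply sum_n_ext. intros n. Rops. unfold w.
      rewrite !pow_mult, pow2_abs. specialize (Hpos n). field. split; lra.
Qed.
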